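(* Let $\mathcal H_1,\mathcal H_2$ be complex Banach spaces, $\Theta\subset\mathbb C$ open, and let $\Theta\ni z\mapsto A_z\in\mathcal C(\mathcal H_2,\mathcal H_1)$ and $\Theta\ni z\mapsto B_z\in\mathcal C(\mathcal H_1,\mathcal H_2)$ be holomorphic. Assume that there exists $\lambda\in\mathbb C$ such that $\lambda^2\in\mathrm{rs}(A_zB_z)\cap\mathrm{rs}(B_zA_z)$ for all $z\in\Theta$. Then both $\Theta\ni z\mapsto A_zB_z$ and $\Theta\ni z\mapsto B_zA_z$ are holomorphic.
   Context: $\mathcal C(\cdot,\cdot)$ denotes closed operators (defined on a linear subspace, not necessarily dense). The product $AB$ has domain $\mathrm{Dom}(AB)=\{v\in\mathrm{Dom}(B):Bv\in\mathrm{Dom}(A)\}$. The resolvent set $\mathrm{rs}(T)$ of an operator $T$ on $\mathcal H$ is the set of $\mu\in\mathbb C$ such that $T-\mu 1$ is a closed operator, injective, with range $\mathcal H$ (hence with bounded everywhere defined inverse); in particular $\mathrm{rs}(T)\ne\emptyset$ implies that $T$ is closed. A function $z\mapsto T_z\in\mathcal C(\mathcal H_1,\mathcal H_2)$ is complex differentiable at $z_0\in\Theta$ if there exist an open $\Theta_0$ with $z_0\in\Theta_0\subset\Theta$, a Banach space $\mathcal K$ and bounded injective operators with closed range $R_z:\mathcal K\to\mathcal H_1\oplus\mathcal H_2$, $z\in\Theta_0$, such that $R_z$ is a bijection of $\mathcal K$ onto the graph $\mathrm{Gr}(T_z)=\{(x,T_zx):x\in\mathrm{Dom}(T_z)\}$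 for all $z\in\Theta_0$ and $z\mapsto R_z$ is complex differentiable at $z_0$ in operator norm. It is holomorphic if it is complex differentiable at every point of $\Theta$ (same definition for any pair of Banach spaces). *)

(* Defs.v *)
From HB Require Import structures.
From mathcomp Require Import all_boot all_order all_algebra complex.
From mathcomp Require Import boolp classical_sets reals topology normedtype.

Set Implicit Arguments.
Unset Strict Implicit.
Unset Printing Implicit Defensive.

Import Order.TTheory GRing.Theory Num.Theory.
Import numFieldNormedType.Exports.

Local Open Scope classical_set_scope.
Local Open Scope ring_scope.
Local Open Scope complex_scope.

(* Partial linear operators from [U] to [V]. Only the values of [opfun] on [dom]
   are meaningful. *)
Record operator (K : numFieldType) (U V : normedModType K) := Operator {
  dom : set U;
  opfun :> U -> V;
  dom0 : dom 0;
  dom_linear : forall (a : K) (x y : U), dom x -> dom y -> dom (a *: x + y);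
  op_linear : forall (a : K) (x y : U), dom x -> dom y ->
    opfun (a *: x + y) = a *: opfun x + opfun y
}.

Section Operators.
Context (K : numFieldType).
Implicit Types U V W : normedModType K.

Definition graph U V (T : operator U V) : set (U * V) :=
  [set p | dom T p.1 /\ p.2 = T p.1].

Definition closed_op U V (T : operator U V) := closed (graph T).

Section Comp.
Context U V W (A : operator V W) (B : operator U V).

Let comp_dom : set U := [set x | dom B x /\ dom A (B x)].

Fact comp_dom0 : comp_dom 0.
Proof.
have B0 : B 0 = 0.
  have := op_linear (-1) (dom0 B) (dom0 B).
  by rewrite !scaleN1r oppr0 addr0 addNr.
by split; rewrite ?B0; exact: dom0.
Qed.

Fact comp_dom_linear (a : K) (x y : U) :
  comp_dom x -> comp_dom y -> comp_dom (a *: x + y).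
Proof.
move=> [Bx ABx] [By ABy]; split; first exact: dom_linear.
by rewrite op_linear//; exact: dom_linear.
Qed.

Fact comp_linear (a : K) (x y : U) : comp_dom x -> comp_dom y ->
  A (B (a *: x + y)) = a *: A (B x) + A (B y).
Proof. by move=> [Bx ABx] [By ABy]; rewrite !op_linear. Qed.

Definition comp_op : operator U W :=
  @Operator K U W comp_dom (fun x => A (B x)) comp_dom0 comp_dom_linear
    comp_linear.

End Comp.

Section SubScalar.
Context U (T : operator U U) (mu : K).

Fact sub_scalar_linear (a : K) (x y : U) : dom T x -> dom T y ->
  T (a *: x + y) - mu *: (a *: x + y) =
  a *: (T x - mu *: x) + (T y - mu *: y).
Proof.
move=> Tx Ty; rewrite op_linear// scalerBr scalerDr opprD addrACA.
by rewrite !scalerA [mu * a]mulrC.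
Qed.

Definition sub_scalar : operator U U :=
  @Operator K U U (dom T) (fun x => T x - mu *: x) (dom0 T)
    (@dom_linear K U U T) sub_scalar_linear.

End SubScalar.

Definition resolvent_set U (T : operator U U) : set K :=
  [set mu | let S := sub_scalar T mu in
    [/\ closed_op S,
        (forall x y, dom S x -> dom S y -> S x = S y -> x = y) &
        (forall y, exists2 x, dom S x & S x = y)]].

Definition bounded_op U V (f : U -> V) :=
  exists M : K, forall x, `|f x| <= M * `|x|.

End Operators.

Section Holomorphic.
Context (R : realType).

(* The norm of a complex normed space takes nonnegative real values in [R[i]];
   [complex.Re] turns it into an element of [R]. *)
Definition opnorm (U V : normedModType R[i]) (f : U -> V) : R :=
  sup [set complex.Re `|f x| | x in [set x : U | `|x| <= 1]].

(* Complex differentiability at [z0], in operator norm, of a family of bounded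
   operators. *)
Definition opnorm_differentiable (U V : normedModType R[i])
    (F : R[i] -> {linear U -> V}) (z0 : R[i]) :=
  exists2 D : {linear U -> V}, bounded_op D &
    opnorm (fun x => h^-1 *: (F (z0 + h) x - F z0 x) - D x)
      @[h --> (0 : R[i]^o)^'] --> (0 : R).

(* The product [H1 * H2] carries the max norm. The regular algebra [R[i]^o] is
   [R[i]] with the topology of its modulus. *)
Definition differentiable_op (H1 H2 : completeNormedModType R[i])
    (Theta : set R[i]^o) (T : R[i] -> operator H1 H2) (z0 : R[i]) :=
  exists Theta0 : set R[i]^o,
    [/\ open Theta0, Theta0 z0, Theta0 `<=` Theta &
    exists (K : completeNormedModType R[i])
           (F : R[i] -> {linear K -> (H1 * H2)%type}),
      (forall z, Theta0 z ->
        [/\ bounded_op (F z), injective (F z), closed (range (F z)) &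
            range (F z) = graph (T z)]) /\
      opnorm_differentiable F z0].

Definition holomorphic_op (H1 H2 : completeNormedModType R[i])
    (Theta : set R[i]^o) (T : R[i] -> operator H1 H2) :=
  forall z, Theta z -> closed_op (T z) /\ differentiable_op Theta T z.

End Holomorphic.

(* Main.v *)
Require Import Defs.
From HB Require Import structures.
From mathcomp Require Import all_boot all_order all_algebra complex.
From mathcomp Require Import boolp classical_sets reals topology normedtype.
From mathcomp Require Import prodnormedzmodule.
From mathcomp Require Import ring lra.

Set Implicit Arguments.
Unset Strict Implicit.
Unset Printing Implicit Defensive.

Import Order.TTheory GRing.Theory Num.Theory.
Import numFieldNormedType.Exports.

Local Open Scope classical_set_scope.
Local Open Scope ring_scope.
Local Open Scope complex_scope.

(* Put mu = lambda^2 and parametrize Gr(A_z), Gr(B_z) by a_z, b_z on Banach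
   spaces KA, KB.  On KA * KB consider the bounded operators
     G_z (k, l) = (A y - mu x, B x - y),    F_z (k, l) = (x, A y),
   where a_z k = (y, A_z y) and b_z l = (x, B_z x).  As mu is in rs(AB) and
   rs(BA), G_z is bijective: G_z = (f, 0) means y = B x and (AB - mu) x = f, and
   (0, g) is attained at x = A w, y = mu w with w = (BA - mu)^-1 g.  Hence
   f |-> F_z (G_z^-1 (f, 0)) parametrizes Gr(A_z B_z) by H1.  By the open mapping
   theorem G_z^-1 is bounded, and the quotient rule
     (F G^-1)' = (F' - F G^-1 G') G^-1
   shows that this parametrization is complex differentiable. *)

(** * Real-valued norms and bounds *)

Section RealNorm.
Context (R : realType).
Implicit Types U V W : normedModType R[i].

(** The norm takes values in [R[i]], which is only partially ordered; its real part carries the same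
    information in the ordered field [R], where estimates are linear arithmetic. *)
Definition rnorm V (x : V) : R := complex.Re `|x|.

Lemma rnormE V (x : V) : `|x| = (rnorm x)%:C.
Proof. by rewrite /rnorm RRe_real// realE normr_ge0. Qed.

Lemma ltr0c (a : R) : (0 < a%:C) = (0 < a).
Proof. exact: ltcR. Qed.

Lemma rnorm_ge0 V (x : V) : 0 <= rnorm x.
Proof. by rewrite -ler0c -rnormE. Qed.

Lemma rnormN V (x : V) : rnorm (- x) = rnorm x.
Proof. by rewrite /rnorm normrN. Qed.

Lemma rnormB_sym V (x y : V) : rnorm (x - y) = rnorm (y - x).
Proof. by rewrite /rnorm distrC. Qed.

Lemma rnormD V (x y : V) : rnorm (x + y) <= rnorm x + rnorm y.
Proof. by rewrite -lecR rmorphD/= -!rnormE ler_normD. Qed.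

Lemma rnormB V (x y : V) : rnorm (x - y) <= rnorm x + rnorm y.
Proof. by rewrite -(rnormN y) rnormD. Qed.

Lemma rnormZ V (a : R[i]) (x : V) :
  rnorm (a *: x) = rnorm (a : R[i]^o) * rnorm x.
Proof. by apply: (@complexI R); rewrite rmorphM/= -!rnormE normrZ. Qed.

Lemma rnorm_real (a : R) : 0 <= a -> rnorm (a%:C : R[i]^o) = a.
Proof. by move=> a0; rewrite /rnorm ger0_norm ?ler0c. Qed.

Lemma rnorm0 V : rnorm (0 : V) = 0.
Proof. by rewrite /rnorm normr0. Qed.

Lemma rnorm_eq0 V (x : V) : rnorm x = 0 -> x = 0.
Proof. by move=> x0; apply/normr0_eq0; rewrite rnormE x0. Qed.

Lemma rnorm_gt0 V (x : V) : (0 < rnorm x) = (x != 0).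
Proof. by rewrite -ltr0c -rnormE normr_gt0. Qed.

Lemma rnorm_pair U V (p : U * V) :
  rnorm p = Num.max (rnorm p.1) (rnorm p.2).
Proof.
rewrite {1}/rnorm prod_normE !rnormE.
by rewrite /Order.max ltcR; case: ifP.
Qed.

Lemma rnorm_fst U V (p : U * V) : rnorm p.1 <= rnorm p.
Proof. by rewrite rnorm_pair le_max lexx. Qed.

Lemma rnorm_snd U V (p : U * V) : rnorm p.2 <= rnorm p.
Proof. by rewrite rnorm_pair le_max lexx orbT. Qed.

(** The bound in [bounded_op] is a complex number [M]. From [0 <= |f x| <= M * |x|] the right-hand
    side is real and nonnegative, hence equal to its modulus, so [|M|] serves as a real bound. *)
Lemma bounded_opP U V (f : U -> V) :
  bounded_op f <-> exists2 M : R, 0 <= M & forall x, rnorm (f x) <= M * rnorm x.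
Proof.
split=> [[M fM]|[M M0 fM]].
  exists (rnorm (M : R[i]^o)); first exact: rnorm_ge0.
  move=> x; have := le_trans (fM x) (real_ler_norm _).
  rewrite normrM normr_id => /(_ _)/wrap[].
    exact: ger0_real (le_trans (normr_ge0 _) (fM x)).
  by rewrite (rnormE (M : R[i]^o)) !rnormE -rmorphM lecR.
by exists M%:C => x; rewrite !rnormE -rmorphM lecR.
Qed.

End RealNorm.

(** * Completeness of products *)

HB.instance Definition _ (U V : puniformType) := Pointed.on (U * V)%type.
HB.instance Definition _ (U V : puniformType) :=
  PointedUniform.on (U * V)%type.

(** Both projections of a Cauchy filter are Cauchy, and the pair of their limits is a limit of the
    filter. This makes [KA * KB] and [U * V] Banach spaces, to which the open mapping theorem
    applies. *)
Lemma prod_complete (U V : completeType) (F : set_system (U * V)%type) :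
  ProperFilter F -> cauchy F -> cvg F.
Proof.
move=> FF Fc.
have Fc1 : cauchy (fst @ F).
  move=> A /= entA; rewrite near_simpl -near2E near_map2; apply: Fc.
  by apply: filterS (prod_entP entA entourageT) => p [].
have Fc2 : cauchy (snd @ F).
  move=> A /= entA; rewrite near_simpl -near2E near_map2; apply: Fc.
  by apply: filterS (prod_entP entourageT entA) => p [].
have [u Fu] := (cvg_ex _).1 (cauchy_cvg _ Fc1).
have [v Fv] := (cvg_ex _).1 (cauchy_cvg _ Fc2).
apply/cvg_ex; exists (u, v) => B [[P Q] [/= /Fu Pu /Fv Qv] PQB].
have FPQ : F (P `*` Q).
  exact: (@filterI _ F _ (fst @^-1` P) (snd @^-1` Q) Pu Qv).
exact: filterS PQB FPQ.
Qed.

HB.instance Definition _ (K : numFieldType) (U V : completeNormedModType K) :=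
  Uniform_isComplete.Build (U * V)%type (@prod_complete U V).

(** * Baire category argument and open mapping theorem *)

Section OpenMapping.
Context (R : realType).

Lemma exists_half_pow_lt (M d : R) : 0 < d -> exists n : nat, M / 2 ^+ n < d.
Proof.
move=> d0; exists (Num.truncn (M / d)).+1.
rewrite ltr_pdivrMr ?exprn_gt0// mulrC -ltr_pdivrMr//.
apply: (lt_le_trans (truncnS_gt _)).
by rewrite -natrX ler_nat ltnW// ltn_expl.
Qed.

(** The number [e n] bounds the tail of the series of increments: these telescope, so every later
    term is within [e n] of [a n], and the limit inherits the bound. Used for shrinking balls and
    for successive approximation. *)
Lemma telescoping_cvg (V : completeNormedModType R[i]) (a : nat -> V)
    (e : nat -> R) :
  (forall n, rnorm (a n.+1 - a n) <= e n - e n.+1) ->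
  (forall n, 0 <= e n) -> (forall d, 0 < d -> exists n, e n < d) ->
  exists l, forall n, rnorm (l - a n) <= e n.
Proof.
move=> ae e0 e_small.
have dist_a n k : rnorm (a (n + k)%N - a n) <= e n - e (n + k)%N.
  elim: k => [|k IHk]; first by rewrite addn0 !subrr rnorm0.
  have := rnormD (a (n + k).+1 - a (n + k)%N) (a (n + k)%N - a n).
  have := ae (n + k)%N; rewrite addnS addrA subrK; lra.
have cvg_a : cvg (a @ \oo).
  apply: cauchy_cvg; apply: cauchy_exP => d d0.
  have dE : d = (complex.Re d)%:C by rewrite RRe_real// gtr0_real.
  move: d0; rewrite dE ltr0c => {dE}; set d' := complex.Re d => d'0.
  have [n en] := e_small _ d'0.
  exists (a n), n => // m /= nm.
  rewrite -ball_normE /= rnormE ltcR rnormB_sym -(subnKC nm).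
  by have := dist_a n (m - n)%N; have := e0 (n + (m - n))%N; lra.
have [l al] := (cvg_ex _).1 cvg_a.
exists l => n; apply/ler_addgt0Pr => d d0.
have d0' : 0 < d%:C :> R[i] by rewrite ltr0c.
have [N _ aN] := (cvgrPdist_lt _ _).1 al _ d0'.
have := aN (n + N)%N (leq_addl _ _); rewrite /= rnormE ltcR => lt_d.
have := rnormD (l - a (n + N)%N) (a (n + N)%N - a n).
rewrite addrA subrK; have := dist_a n N; have := e0 (n + N)%N; lra.
Qed.

Section Surjective.
Context (X Y : completeNormedModType R[i]) (G : {linear X -> Y}).
Hypothesis surjG : forall y, exists x, G x = y.

(** The closure of the image of some ball of radius [n] has an interior point. Otherwise there are
    shrinking balls, each avoiding the image of the next ball of [X]; their common point [l] could
    have no preimage. *)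
Lemma baire_image_ball : exists (n : nat) (y0 : Y), exists2 r : R, 0 < r &
  forall y (e : R), rnorm (y - y0) < r -> 0 < e ->
    exists2 x, rnorm x <= n%:R & rnorm (y - G x) < e.
Proof.
apply: contrapT => noball.
have avoid n y0 (r : R) : 0 < r -> exists y, exists2 s, 0 < s &
    rnorm (y - y0) < r /\ forall x, rnorm x <= n%:R -> s <= rnorm (y - G x).
  move=> r0; apply: contrapT => navoid; apply: noball.
  exists n, y0, r => // y e yr e0; apply: contrapT => nx.
  apply: navoid; exists y, e => //; split=> // x xn; rewrite leNgt.
  by apply/negP => xe; apply: nx; exists x.
(* The positivity premise makes the relation total, as [choice] requires. Moving the center by at
   most [r / 4] and at least halving the radius gives increments of at most [r / 2 - s / 2], the
   telescoping form for half the radii. *)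
have step (q : nat * (Y * R)) : exists p : Y * R, 0 < q.2.2 ->
    [/\ rnorm (p.1 - q.2.1) <= q.2.2 / 4, 0 < p.2, p.2 <= q.2.2 / 2 &
        forall x, rnorm x <= q.1%:R -> p.2 <= rnorm (p.1 - G x)].
  case: q => n [y0 r] /=; have [r0|r0] := ltP 0 r; last by exists (y0, r).
  have [|y [s s0 [yr ys]]] := avoid n y0 (r / 4); first by lra.
  exists (y, Num.min s (r / 2)) => _ /=; split.
  - exact: ltW.
  - by rewrite lt_min s0; lra.
  - by rewrite ge_min lexx orbT.
  - by move=> x /ys; rewrite ge_min => ->.
have [f fP] := choice step.
pose fix p n := if n is m.+1 then f (m, p m) else (0 : Y, 1 : R).
have p_gt0 n : 0 < (p n).2.
  by elim: n => [|n IHn] /=; [exact: ltr01|have [] := fP (n, p n) IHn].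
have pS n := fP (n, p n) (p_gt0 n).
have p_small n : (p n).2 <= 1 / 2 ^+ n.
  elim: n => [|n IHn]; first by rewrite expr0 divr1.
  have [_ _ /= ple _] := pS n; rewrite exprSr invfM mulrA.
  by apply: (le_trans ple); rewrite ler_pM2r// invr_gt0.
have [|||l lp] := @telescoping_cvg Y (fun n => (p n).1) (fun n => (p n).2 / 2).
- move=> n; have [/= + _ + _] := pS n; lra.
- by move=> n; have := p_gt0 n; lra.
- move=> d d0; have [n nd] := exists_half_pow_lt 1 d0; exists n.
  by have := p_small n; have := p_gt0 n; lra.
(* As [rnorm x <= n], the center of index [n.+1] is at least its radius away from [G x = l], yet [l]
   lies within half that radius. *)
have [x xl] := surjG l; pose n := (Num.truncn (rnorm x)).+1.
have [_ _ _ /(_ x)] := pS n; rewrite xl rnormB_sym => /(_ _)/wrap[].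
  by rewrite ltW// truncnS_gt.
by have := lp n.+1; have := p_gt0 n.+1; rewrite /=; lra.
Qed.

(** Scale [y] by [t] so that [t y + y0] lies in the ball around [y0], and approximate both
    [t y + y0] and [y0] by images of vectors of norm at most [n]. The difference of these vectors,
    divided by [t], is the approximate preimage. *)
Lemma approximate_preimage : exists2 C : R, 0 <= C & forall y, exists2 x,
  rnorm x <= C * rnorm y & rnorm (y - G x) <= rnorm y / 2.
Proof.
have [n [y0 [r r0 nr]]] := baire_image_ball.
exists (4 * n%:R / r); first by rewrite divr_ge0// ?mulr_ge0// ltW.
move=> y.
have [y00|y0'] := eqVneq (rnorm y) 0.
  by exists 0; rewrite ?rnorm0 ?linear0 ?subr0 ?addr0 ?y00 ?mulr0 ?mul0r lexx.
have {y0'}y_gt0 : 0 < rnorm y by rewrite lt0r y0' rnorm_ge0.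
pose t := r / (2 * rnorm y).
have t0 : 0 < t by rewrite divr_gt0// mulr_gt0.
have tyE : t * rnorm y = r / 2 by rewrite /t; field; lra.
(* Two errors below [e] add up to at most [t * rnorm y / 2], the permitted error after scaling by
   [t]. *)
pose e := t * (rnorm y / 2) / 2.
have e0 : 0 < e by rewrite /e; nra.
have [|//|x1 x1n x1e] := nr (t%:C *: y + y0) e.
  by rewrite addrK rnormZ (rnorm_real (ltW t0)) tyE; lra.
have [|//|x2 x2n x2e] := nr y0 e; first by rewrite subrr rnorm0.
exists (t^-1%:C *: (x1 - x2)).
  rewrite rnormZ rnorm_real ?invr_ge0 ?(ltW t0)// ler_pdivrMl//.
  apply: (le_trans (rnormB _ _)).
  have -> : t * (4 * n%:R / r * rnorm y) = 2 * n%:R.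
    by rewrite mulrCA tyE; field; lra.
  by move: x1n x2n; lra.
rewrite -(ler_pM2l t0); have := rnormZ t%:C (y - G (t^-1%:C *: (x1 - x2))).
rewrite (rnorm_real (ltW t0)) => <-.
rewrite scalerBr (linearZ_LR G) scalerA -rmorphM/= divff ?gt_eqF//.
rewrite rmorph1 scale1r linearB.
have -> : t%:C *: y - (G x1 - G x2) =
    (t%:C *: y + y0 - G x1) - (y0 - G x2).
  by rewrite [in RHS]opprB [G x2 - y0]addrC addrACA addrK opprB [- _ + _]addrC.
have := rnormB (t%:C *: y + y0 - G x1) (y0 - G x2).
by move: x1e x2e; rewrite /e; lra.
Qed.

Hypothesis bndG : exists2 M : R, 0 <= M & forall x, rnorm (G x) <= M * rnorm x.

(** Correcting by an approximate preimage of the residual halves the residual each time. The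
    corrections form a geometrically bounded series, whose sum has norm at most
    [2 * C * rnorm y]. *)
Theorem open_mapping : exists2 C : R, 0 <= C &
  forall y, exists2 x, G x = y & rnorm x <= C * rnorm y.
Proof.
have [C C0 appr] := approximate_preimage.
have /choice[u uP] y : exists x,
    rnorm x <= C * rnorm y /\ rnorm (y - G x) <= rnorm y / 2.
  by have [x ? ?] := appr y; exists x.
exists (2 * C) => [|y]; first by rewrite mulr_ge0.
pose fix x n := if n is m.+1 then x m + u (y - G (x m)) else 0.
have resid n : rnorm (y - G (x n)) <= rnorm y / 2 ^+ n.
  elim: n => [|n IHn]; first by rewrite /= linear0 subr0 expr0 divr1.
  have [_] := uP (y - G (x n)); rewrite /= linearD opprD addrA exprSr invfM.
  by move: IHn; lra.
(* This is the sum of the bounds [C * rnorm y / 2 ^+ k] on the corrections with [k >= n]. *)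
pose e n := 2 * C * rnorm y / 2 ^+ n.
have e0 n : 0 <= e n by rewrite /e !mulr_ge0 ?rnorm_ge0 ?invr_ge0 ?exprn_ge0.
have [||l lx] := telescoping_cvg _ e0 (a := x).
- move=> n; have [+ _] := uP (y - G (x n)); rewrite /= addrAC subrr add0r.
  move=> /le_trans; apply; rewrite /e exprSr invfM.
  have := ler_wpM2l C0 (resid n); lra.
- by move=> d /(exists_half_pow_lt (2 * C * rnorm y)).
exists l; last by have := lx 0; rewrite subr0 /e expr0 divr1.
have [M M0 GM] := bndG.
(* [G l = y], because the distance is at most [M * e n] plus the residual at [n], and both tend to
   zero. *)
apply/eqP; rewrite -subr_eq0; apply/eqP/rnorm_eq0/eqP.
rewrite eq_le rnorm_ge0 andbT; apply/ler_addgt0Pr => d d0; rewrite add0r.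
have [n nd] := exists_half_pow_lt (M * (2 * C * rnorm y) + rnorm y) d0.
have := rnormD (G l - G (x n)) (G (x n) - y).
rewrite addrA subrK -linearB [X in _ <= _ + X]rnormB_sym.
have := resid n; have := GM (l - x n).
have := ler_wpM2l M0 (lx n).
by move: nd; rewrite /e; lra.
Qed.
End Surjective.
End OpenMapping.

(** * Operator-norm differentiability in epsilon-delta form *)

Section OperatorDerivative.
Context (R : realType).

(** The bound is uniform in [x] and already multiplied by [h], so that neither a supremum nor a
    quotient occurs in later estimates. *)
Definition has_deriv (U V : normedModType R[i]) (F : R[i] -> U -> V)
    (D : U -> V) (z0 : R[i]) :=
  forall e : R, 0 < e -> exists2 d : R, 0 < d &
    forall h : R[i], h != 0 -> rnorm (h : R[i]^o) < d -> forall x,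
    rnorm (F (z0 + h) x - F z0 x - h *: D x)
      <= e * rnorm (h : R[i]^o) * rnorm x.

Lemma opnorm_le (U V : normedModType R[i]) (f : U -> V) (e : R) : 0 <= e ->
  (forall x, rnorm (f x) <= e * rnorm x) -> 0 <= opnorm f <= e.
Proof.
move=> e0 fe.
pose S := [set complex.Re `|f x| | x in [set x : U | `|x| <= 1]].
have S0 : S (rnorm (f 0)) by exists 0 => //=; rewrite normr0.
have Se : ubound S e.
  move=> _ [x /= x1 <-]; apply: (le_trans (fe x)).
  move: x1; rewrite rnormE -(rmorph1 (real_complex R)) lecR => x1.
  by rewrite ler_piMr.
apply/andP; split; last by apply: ge_sup => //; exists (rnorm (f 0)).
apply: (le_trans (rnorm_ge0 (f 0))); apply: sup_upper_bound => //.
by split; [exists (rnorm (f 0))|exists e].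
Qed.

(** Rescale [x] to norm one. Boundedness ensures that the [sup] in [opnorm] is a true least upper
    bound and not the default value. *)
Lemma rnorm_le_opnorm (U V : normedModType R[i]) (f : {linear U -> V})
    (x : U) :
  bounded_op f -> rnorm (f x) <= opnorm f * rnorm x.
Proof.
move=> /bounded_opP[M M0 fM].
have [->|x0] := eqVneq x 0; first by rewrite linear0 !rnorm0 mulr0.
have nx0 : 0 < rnorm x by rewrite rnorm_gt0.
rewrite -ler_pdivrMr// mulrC.
have nxV0 : 0 <= (rnorm x)^-1 by rewrite invr_ge0 ltW.
have -> : (rnorm x)^-1 * rnorm (f x) = rnorm (f ((rnorm x)^-1%:C *: x)).
  by rewrite linearZ_LR rnormZ rnorm_real.
apply: sup_upper_bound; last first.
  exists ((rnorm x)^-1%:C *: x) => //=.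
  by rewrite rnormE rnormZ rnorm_real// mulVf ?gt_eqF.
split; first by exists (rnorm (f 0)), 0 => //=; rewrite normr0.
exists M => _ [y /= y1 <-]; apply: (le_trans (fM y)).
move: y1; rewrite rnormE -(rmorph1 (real_complex R)) lecR => y1.
by rewrite ler_piMr.
Qed.

Lemma open_rnormP (T : set R[i]^o) (z0 : R[i]) : open T -> T z0 ->
  exists2 d : R, 0 < d & forall h, rnorm (h : R[i]^o) < d -> T (z0 + h).
Proof.
move=> oT Tz0; have /nbhs_ballP[d /= d0 dT] : nbhs (z0 : R[i]^o) T.
  exact: open_nbhs_nbhs.
have dE : d = (complex.Re d)%:C by rewrite RRe_real// gtr0_real.
exists (complex.Re d) => [|h hd]; first by rewrite -ltr0c -dE.
by apply: dT; rewrite -ball_normE /= opprD addNKr normrN rnormE dE ltcR.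
Qed.

(** Boundedness of [F z] on a whole neighborhood makes the difference quotients bounded, so their
    [opnorm] controls them pointwise. *)
Lemma opnorm_differentiableP (U V : normedModType R[i])
    (F : R[i] -> {linear U -> V}) (z0 : R[i]) (T : set R[i]^o) :
  open T -> T z0 -> (forall z, T z -> bounded_op (F z)) ->
  opnorm_differentiable F z0 <->
  exists2 D : {linear U -> V}, bounded_op D & has_deriv F D z0.
Proof.
move=> oT Tz0 bF; split=> -[D bD FD]; exists D => //.
  move=> e e0.
  have := (cvgrPdist_lt _ _).1 FD _ e0.
  rewrite /= => /(_ (within_filter _ _)) near_e.
  have [d d0 dF] := (nbhs_ballP _ _).1 near_e.
  have dE : d = (complex.Re d)%:C by rewrite RRe_real// gtr0_real.
  have [d' d'0 d'T] := open_rnormP oT Tz0.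
  exists (Num.min d' (complex.Re d)).
    by rewrite lt_min d'0 -ltr0c -dE.
  move=> h h0; rewrite lt_min => /andP[hd' hd] x.
  (* The error of the difference quotient is packaged as a bounded linear map [g], to which
     [rnorm_le_opnorm] applies. *)
  pose f x := h^-1 *: (F (z0 + h) x - F z0 x) - D x.
  have lf : linear f.
    move=> a u v; rewrite /f (linearP (F (z0 + h))) (linearP (F z0)) (linearP D).
    rewrite opprD addrACA -scalerBr scalerDr.
    by rewrite scalerA [h^-1 * a]mulrC -scalerA opprD addrACA -scalerBr.
  pose g : {linear U -> V} := HB.pack f (GRing.isLinear.Build _ _ _ _ _ lf).
  have bg : bounded_op g.
    have /bounded_opP[M1 M10 FM1] := bF _ (d'T h hd').
    have /bounded_opP[M0 M00 FM0] := bF _ Tz0.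
    have /bounded_opP[M M_0 DM] := bD.
    pose c := rnorm (h^-1 : R[i]^o).
    have c0 : 0 <= c by exact: rnorm_ge0.
    apply/bounded_opP; exists (c * (M1 + M0) + M).
      by rewrite !(addr_ge0, mulr_ge0).
    move=> y; apply: (le_trans (rnormB _ _)); rewrite rnormZ -/c.
    have := ler_wpM2l c0 (rnormB (F (z0 + h) y) (F z0 y)).
    have := ler_wpM2l c0 (lerD (FM1 y) (FM0 y)).
    by have := DM y; lra.
  have fh : F (z0 + h) x - F z0 x - h *: D x = h *: f x.
    by rewrite /f scalerBr scalerA divff// scale1r.
  rewrite fh rnormZ [e * _]mulrC -mulrA ler_wpM2l ?rnorm_ge0//.
  have := rnorm_le_opnorm x bg; rewrite /= => /le_trans; apply.
  rewrite ler_wpM2r ?rnorm_ge0//.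
  have := dF h; rewrite -ball_normE /= sub0r normrN dE rnormE ltcR.
  move=> /(_ hd h0).
  by rewrite sub0r normrN => /ltW; apply: le_trans; exact: ler_norm.
have FF : Filter (0 : R[i]^o)^' by exact: within_filter.
apply/cvgrPdist_le => e e0; have [d d0 dF] := FD _ e0.
rewrite /prop_near1 /= /dnbhs /within /=; apply/nbhs_ballP.
exists d%:C => /=; first by rewrite ltr0c.
move=> h; rewrite -ball_normE /= sub0r normrN rnormE ltcR => hd h0.
rewrite sub0r normrN.
have /andP[] : 0 <=
    opnorm (fun x => h^-1 *: (F (z0 + h) x - F z0 x) - D x) <= e.
  apply: opnorm_le; first exact: ltW.
  move=> x; have f_h : h *: (h^-1 *: (F (z0 + h) x - F z0 x) - D x) =
      F (z0 + h) x - F z0 x - h *: D x.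
    by rewrite scalerBr scalerA divff// scale1r.
  rewrite -(@ler_pM2l _ (rnorm (h : R[i]^o))) ?rnorm_gt0//.
  by rewrite -rnormZ f_h mulrA [_ * e]mulrC; exact: dF.
by move=> op0 ope; rewrite ger0_norm.
Qed.

End OperatorDerivative.

(** * The quotient rule for operator families *)

Section QuotientRule.
Context (R : realType).
Implicit Types U V W K : normedModType R[i].

(** The lower bound makes the surjection [G] bijective, and [H] is [F] composed with its inverse.
    This yields both the quotients [F G^-1] and the derivative at [z0]. *)
Lemma linear_factor K V W (G : {linear K -> V}) (F : {linear K -> W}) (C : R) :
  0 <= C -> (forall y, exists x, G x = y) ->
  (forall k, rnorm k <= C * rnorm (G k)) -> bounded_op F ->
  exists2 H : {linear V -> W}, bounded_op H & forall k, H (G k) = F k.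
Proof.
move=> C0 surjG GC /bounded_opP[M M0 FM].
have [g gK] := choice surjG.
have injG : injective G.
  move=> k k' /eqP; rewrite -subr_eq0 -linearB => /eqP Gkk'.
  have := GC (k - k'); rewrite Gkk' rnorm0 mulr0 => kk'.
  apply/eqP; rewrite -subr_eq0; apply/eqP/rnorm_eq0/eqP.
  by rewrite eq_le kk' rnorm_ge0.
have lh : linear (F \o g).
  move=> a u v /=; rewrite -linearP; congr (F _); apply: injG.
  by rewrite linearP !gK.
pose H : {linear V -> W} :=
  HB.pack (F \o g) (GRing.isLinear.Build _ _ _ _ _ lh).
exists H; last by move=> k /=; congr (F _); apply: injG; rewrite gK.
apply/bounded_opP; exists (M * C) => [|v /=]; first exact: mulr_ge0.
apply: (le_trans (FM _)); rewrite -mulrA ler_wpM2l//.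
by apply: (le_trans (GC _)); rewrite gK.
Qed.

(** Regrouping for the quotient rule: [p] is the common value [F z0 k = H z0 (G z0 k)], while [q]
    and [s] are the first-order terms of [F] and of [H z0] after [G]. *)
Lemma quotient_remainder (Z : zmodType) (A B c p q s : Z) :
  A - B - c = (A - p - q) - (B - p - s) - (c - (q - s)).
Proof.
have E (a b d : Z) : (a + q + p) - (b + s + p) - (d + (q - s)) = a - b - d.
  have -> : a + q + p - (b + s + p) = a - b + (q - s).
    by rewrite opprD addrACA subrr addr0 opprD addrACA.
  by rewrite opprD addrACA subrr addr0.
by rewrite -(E (A - p - q)) !subrK.
Qed.

(** Testing at [y = G (z0 + h) k] turns the remainder of [H] into [r' - H z0 r - h D (h DG k + r)],
    where [r] and [r'] are the remainders of [G] and [F]. The lower bound at [z0] persists for small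
    [h], with [2 * C] in place of [C]. *)
Lemma has_deriv_quotient K V W (F : R[i] -> {linear K -> W})
    (G : R[i] -> {linear K -> V}) (H : R[i] -> {linear V -> W})
    (DF : {linear K -> W}) (DG : {linear K -> V}) (D : {linear V -> W})
    (T : set R[i]^o) (z0 : R[i]) (C : R) :
  open T -> T z0 -> 0 <= C ->
  (forall z, T z -> forall y, exists x, G z x = y) ->
  (forall k, rnorm k <= C * rnorm (G z0 k)) ->
  (forall z, T z -> forall k, H z (G z k) = F z k) ->
  (forall k, D (G z0 k) = DF k - H z0 (DG k)) ->
  bounded_op (H z0) -> bounded_op DG -> bounded_op D ->
  has_deriv F DF z0 -> has_deriv G DG z0 -> has_deriv H D z0.
Proof.
move=> oT Tz0 C0 surjG GC HG DE /bounded_opP[MH MH0 HM].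
move=> /bounded_opP[MG MG0 DGM] /bounded_opP[MD MD0 DM] dF dG e e0.
have [dT dT0 hT] := open_rnormP oT Tz0.
(* With [rnorm k <= 2 * C * rnorm y], the choices of [eta] and [d4] each cost at most [e / 2] in the
   final bound, and [d3] makes the perturbation of [G] at most half the lower bound. Adding 1 to
   [C], [MG] and [MD] keeps the divisors positive. *)
pose eta := Num.min 1 (e / (4 * (C + 1) * (1 + MH))).
have eta0 : 0 < eta.
  by rewrite lt_min ltr01 divr_gt0// !mulr_gt0//; lra.
have eta1 : eta <= 1 by rewrite ge_min lexx.
have etaE : eta * (4 * (C + 1) * (1 + MH)) <= e.
  by rewrite -ler_pdivlMr ?ge_min ?lexx ?orbT// !mulr_gt0//; lra.
have [d1 d10 rF] := dF _ eta0.
have [d2 d20 rG] := dG _ eta0.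
pose d3 := (2 * (C + 1) * (MG + 1))^-1.
have d30 : 0 < d3 by rewrite invr_gt0 !mulr_gt0//; lra.
have d3E : d3 * (2 * (C + 1) * (MG + 1)) = 1.
  by rewrite mulVf// gt_eqF// !mulr_gt0//; lra.
pose d4 := e / (4 * (MD + 1) * (MG + 1) * (C + 1)).
have d40 : 0 < d4 by rewrite divr_gt0// !mulr_gt0//; lra.
have d4E : d4 * (4 * (MD + 1) * (MG + 1) * (C + 1)) = e.
  by rewrite mulfVK// gt_eqF// !mulr_gt0//; lra.
clearbody eta d3 d4.
exists (Num.min dT (Num.min (Num.min d1 d2) (Num.min d3 d4))).
  by rewrite !lt_min dT0 d10 d20 d30 d40.
move=> h h0; rewrite !lt_min => /andP[/hT Th /andP[/andP[hd1 hd2]]].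
move=> /andP[hd3 hd4] y.
have [k <-] := surjG _ Th y.
rewrite (HG _ Th).
pose r := G (z0 + h) k - G z0 k - h *: DG k.
pose r' := F (z0 + h) k - F z0 k - h *: DF k.
have := rG h h0 hd2 k; have := rF h h0 hd1 k.
rewrite -/r -/r' => {rF rG} rF rG.
have -> : F (z0 + h) k - H z0 (G (z0 + h) k) - h *: D (G (z0 + h) k) =
    r' - H z0 r - h *: D (h *: DG k + r).
  rewrite /r /r'.
  have -> : h *: DG k + (G (z0 + h) k - G z0 k - h *: DG k) =
      G (z0 + h) k - G z0 k.
    by rewrite addrC subrK.
  rewrite !(linearB (H z0)) (linearB D) DE (HG _ Tz0) (linearZ_LR (H z0)).
  rewrite scalerBr [h *: (DF k - _)]scalerBr.
  exact: quotient_remainder.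
set x := rnorm (h : R[i]^o) in rF rG hd3 hd4 *.
have x0 : 0 <= x by exact: rnorm_ge0.
have [k0 eta_ge0 d4_ge0] := And3 (rnorm_ge0 k) (ltW eta0) (ltW d40).
have norm_dG : rnorm (h *: DG k + r) <= x * (MG + 1) * rnorm k.
  apply: (le_trans (rnormD _ _)); rewrite rnormZ -/x.
  have := ler_wpM2l x0 (DGM k).
  have := ler_wpM2r k0 (ler_wpM2r x0 eta1).
  by move: rG; lra.
(* Write [G z0 k] as [G (z0 + h) k] minus the increment; [C] times the norm of the increment is at
   most [rnorm k / 2] and is absorbed on the left. *)
have norm_k : rnorm k <= 2 * C * rnorm (G (z0 + h) k).
  have GE : G z0 k = G (z0 + h) k - (h *: DG k + r).
    by rewrite /r [h *: _ + _]addrC subrK opprB addrC subrK.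
  have := GC k; rewrite GE => /le_trans/(_ (ler_wpM2l C0 (rnormB _ _))).
  have := ler_wpM2l C0 norm_dG.
  have : C * (x * (MG + 1) * rnorm k) <= rnorm k / 2.
    have -> : rnorm k / 2 = (C + 1) * (d3 * (MG + 1) * rnorm k).
      have : rnorm k = rnorm k * (d3 * (2 * (C + 1) * (MG + 1))).
        by rewrite d3E mulr1.
      by lra.
    have MG1 : 0 <= MG + 1 by rewrite addr_ge0.
    apply: ler_pM => //; [by rewrite !mulr_ge0|by lra|].
    by rewrite ler_wpM2r// ler_wpM2r ?addr_ge0// ltW.
  by lra.
apply: (@le_trans _ _ (x * ((eta * (1 + MH) + d4 * MD * (MG + 1)) * rnorm k))).
  apply: (le_trans (rnormB _ _)); rewrite rnormZ -/x.
  have := rnormB r' (H z0 r).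
  have := le_trans (HM r) (ler_wpM2l MH0 rG).
  have := ler_wpM2l x0 (le_trans (DM _) (ler_wpM2l MD0 norm_dG)).
  have : x * (MD * (x * (MG + 1) * rnorm k)) <=
      x * (MD * (d4 * (MG + 1) * rnorm k)).
    rewrite ler_wpM2l// ler_wpM2l// ler_wpM2r// ler_wpM2r ?addr_ge0//.
    exact: ltW.
  by lra.
rewrite [e * x]mulrC -[x * e * _]mulrA ler_wpM2l//.
have y0 := rnorm_ge0 (G (z0 + h) k); set Y := rnorm (G _ _) in norm_k y0 *.
have c0 : 0 <= eta * (1 + MH) + d4 * MD * (MG + 1).
  by rewrite !(addr_ge0, mulr_ge0).
apply: (le_trans (ler_wpM2l c0 norm_k)).
rewrite mulrA ler_wpM2r//.
have : 0 <= eta * (1 + MH) by rewrite !(addr_ge0, mulr_ge0).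
have : 0 <= d4 * (MG + 1) * (C + 1) by rewrite !(addr_ge0, mulr_ge0).
have : 0 <= d4 * MD * (MG + 1) by rewrite !(addr_ge0, mulr_ge0).
by move: etaE d4E; lra.
Qed.

End QuotientRule.

(** * Graphs of partial operators *)

Section OperatorGraph.
Context (K : numFieldType).
Implicit Types U V W : normedModType K.

Lemma op0 U V (T : operator U V) : T 0 = 0.
Proof.
have := op_linear (-1) (dom0 T) (dom0 T).
by rewrite !scaleN1r oppr0 addr0 addNr.
Qed.

Lemma graph_rangeP U V W (T : operator U V) (s : W -> (U * V)%type) :
  range s = graph T -> forall k, dom T (s k).1 /\ (s k).2 = T (s k).1.
Proof. by move=> sT k; have : range s (s k) by [exists k]; rewrite sT. Qed.

Lemma graph_range_ex U V W (T : operator U V) (s : W -> (U * V)%type) x :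
  range s = graph T -> dom T x -> exists k, s k = (x, T x).
Proof.
move=> sT Tx; have : graph T (x, T x) by [].
by rewrite -sT => -[k _ <-]; exists k.
Qed.

(** The graph of [T] is the preimage of the graph of [T - mu] under the continuous shear sending
    [(x, y)] to [(x, y - mu x)]. *)
Lemma closed_sub_scalar U (T : operator U U) (mu : K) :
  closed_op (sub_scalar T mu) -> closed_op T.
Proof.
rewrite /closed_op => cT.
have -> : graph T =
    (fun p => (p.1, p.2 - mu *: p.1)) @^-1` graph (sub_scalar T mu).
  apply/seteqP; split=> -[x y] [/= Tx]; first by move=> ->.
  by move=> /addIr.
apply: preimage_closed cT => p _.
apply: cvg_pair; first exact: cvg_fst.
by apply: cvgB; [exact: cvg_snd|apply: cvgZr; exact: cvg_fst].
Qed.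

End OperatorGraph.

(** * Boundedness and derivatives of products and composites *)

Section LinearCombinators.
Context (R : realType).
Implicit Types U V W : normedModType R[i].

Definition pair_map U V W W' (f : U -> W) (g : V -> W') (p : U * V) : W * W' :=
  (f p.1, g p.2).

Fact pair_map_linear U V W W' (f : {linear U -> W}) (g : {linear V -> W'}) :
  linear (pair_map f g).
Proof. by move=> a u v; rewrite /pair_map !linearP. Qed.

HB.instance Definition _ U V W W'
    (f : {linear U -> W}) (g : {linear V -> W'}) :=
  GRing.isLinear.Build _ _ _ _ (pair_map f g) (pair_map_linear f g).

Lemma bounded_pair_map U V W W' (f : {linear U -> W}) (g : {linear V -> W'}) :
  bounded_op f -> bounded_op g -> bounded_op (pair_map f g).
Proof.
move=> /bounded_opP[M M0 fM] /bounded_opP[N N0 gN].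
apply/bounded_opP; exists (M + N) => [|p]; first exact: addr_ge0.
have := ler_wpM2l M0 (rnorm_fst p); have := ler_wpM2l N0 (rnorm_snd p).
have := mulr_ge0 M0 (rnorm_ge0 p); have := mulr_ge0 N0 (rnorm_ge0 p).
rewrite [rnorm (pair_map _ _ _)]rnorm_pair ge_max /=.
by have := fM p.1; have := gN p.2; lra.
Qed.

Lemma bounded_comp U V W (f : V -> W) (g : U -> V) :
  bounded_op f -> bounded_op g -> bounded_op (f \o g).
Proof.
move=> /bounded_opP[M M0 fM] /bounded_opP[N N0 gN].
apply/bounded_opP; exists (M * N) => [|x]; first exact: mulr_ge0.
by apply: (le_trans (fM _)); rewrite -mulrA ler_wpM2l.
Qed.

Lemma bounded_sub U V (f g : U -> V) :
  bounded_op f -> bounded_op g -> bounded_op (f \- g).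
Proof.
move=> /bounded_opP[M M0 fM] /bounded_opP[N N0 gN].
apply/bounded_opP; exists (M + N) => [|x]; first exact: addr_ge0.
by apply: (le_trans (rnormB _ _)); rewrite mulrDl lerD.
Qed.

Lemma has_deriv_pair_map U V W W' (f : R[i] -> {linear U -> W})
    (g : R[i] -> {linear V -> W'}) Df Dg z0 :
  has_deriv f Df z0 -> has_deriv g Dg z0 ->
  has_deriv (fun z => pair_map (f z) (g z)) (pair_map Df Dg) z0.
Proof.
move=> df dg e e0; have [d1 d10 fd] := df _ e0; have [d2 d20 gd] := dg _ e0.
exists (Num.min d1 d2) => [|h h0]; first by rewrite lt_min d10.
rewrite lt_min => /andP[hd1 hd2] p.
rewrite rnorm_pair ge_max; apply/andP; split.
  apply: (le_trans (fd h h0 hd1 p.1)).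
  by rewrite ler_wpM2l ?rnorm_fst// mulr_ge0 ?rnorm_ge0// ltW.
apply: (le_trans (gd h h0 hd2 p.2)).
by rewrite ler_wpM2l ?rnorm_snd// mulr_ge0 ?rnorm_ge0// ltW.
Qed.

Lemma has_deriv_compl U V W (f : {linear V -> W}) (g : R[i] -> U -> V) Dg z0 :
  bounded_op f -> has_deriv g Dg z0 ->
  has_deriv (fun z => f \o g z) (f \o Dg) z0.
Proof.
move=> /bounded_opP[M M0 fM] dg e e0.
have [|d d0 gd] := dg (e / (M + 1)); first by rewrite divr_gt0// ltr_wpDl.
exists d => // h h0 hd x /=.
rewrite -linearB -linearZ_LR -linearB; apply: (le_trans (fM _)).
apply: (le_trans (ler_wpM2l M0 (gd h h0 hd x))).
rewrite !mulrA ler_wpM2r ?rnorm_ge0// ler_wpM2r ?rnorm_ge0//.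
rewrite -mulrA mulrCA ler_piMr ?(ltW e0)//.
by rewrite ler_pdivrMr ?mul1r ?ltr_wpDl// lerDl.
Qed.

Lemma has_deriv_compr U V W (f : R[i] -> V -> W) (g : U -> V) Df z0 :
  bounded_op g -> has_deriv f Df z0 ->
  has_deriv (fun z => f z \o g) (Df \o g) z0.
Proof.
move=> /bounded_opP[M M0 gM] df e e0.
have [|d d0 fd] := df (e / (M + 1)); first by rewrite divr_gt0// ltr_wpDl.
exists d => // h h0 hd x /=; apply: (le_trans (fd h h0 hd (g x))).
have x0 := rnorm_ge0 x; have h0' := rnorm_ge0 (h : R[i]^o).
have eM : 0 <= e / (M + 1) by rewrite divr_ge0 ?addr_ge0// ltW.
apply: (le_trans (ler_wpM2l (mulr_ge0 eM h0') (gM x))).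
rewrite mulrA ler_wpM2r// mulrAC ler_wpM2r// -mulrA ler_piMr ?(ltW e0)//.
by rewrite mulrC ler_pdivrMr ?mul1r ?ltr_wpDl// lerDl.
Qed.

End LinearCombinators.

(** * The linear system whose solutions parametrize the graph of the product *)

Section ProductOperator.
Context (R : realType) (U V : completeNormedModType R[i]) (mu : R[i]).

(* For [q = ((y, A y), (x, B x))] in the product of the graphs this is
   [(A y - mu x, B x - y)]; over [(f, 0)] it says [y = B x, (A B - mu) x = f]. *)
Definition system_map (q : (V * U) * (U * V)) : U * V :=
  (q.1.2 - mu *: q.2.1, q.2.2 - q.1.1).

Definition outer_map (q : (V * U) * (U * V)) : U * U := (q.2.1, q.1.2).

Definition inl_map (x : U) : U * V := (x, 0).

Fact system_map_linear : linear system_map.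
Proof.
move=> a p q; congr pair => /=.
  rewrite scalerDr scalerA [mu * a]mulrC -scalerA opprD addrACA.
  by rewrite scalerBr.
by rewrite opprD addrACA -scalerBr.
Qed.

Fact outer_map_linear : linear outer_map. Proof. by []. Qed.

Fact inl_map_linear : linear inl_map.
Proof. by move=> a x y; congr pair; rewrite /= scaler0 addr0. Qed.

HB.instance Definition _ :=
  GRing.isLinear.Build _ _ _ _ system_map system_map_linear.
HB.instance Definition _ :=
  GRing.isLinear.Build _ _ _ _ outer_map outer_map_linear.
HB.instance Definition _ :=
  GRing.isLinear.Build _ _ _ _ inl_map inl_map_linear.

Lemma bounded_system_map : bounded_op system_map.
Proof.
apply/bounded_opP; have m0 := rnorm_ge0 (mu : R[i]^o).
exists (rnorm (mu : R[i]^o) + 2) => [|q]; first by rewrite addr_ge0.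
have [q11 q12] := (rnorm_fst q.1, rnorm_snd q.1).
have [q21 q22] := (rnorm_fst q.2, rnorm_snd q.2).
have [q1 q2] := (rnorm_fst q, rnorm_snd q).
have := rnorm_ge0 q.
have := ler_wpM2l m0 (le_trans q21 q2); rewrite -rnormZ => mq.
have := mulr_ge0 m0 (rnorm_ge0 q).
rewrite [rnorm (system_map _)]rnorm_pair ge_max /=.
have := rnormB q.1.2 (mu *: q.2.1); have := rnormB q.2.2 q.1.1; lra.
Qed.

Lemma bounded_outer_map : bounded_op outer_map.
Proof.
apply/bounded_opP; exists 1 => // q; rewrite mul1r.
rewrite [rnorm (outer_map _)]rnorm_pair ge_max /=.
rewrite (le_trans (rnorm_fst _) (rnorm_snd _)).
exact: le_trans (rnorm_snd _) (rnorm_fst _).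
Qed.

Lemma bounded_inl_map : bounded_op inl_map.
Proof.
apply/bounded_opP; exists 1 => // x; rewrite mul1r.
by rewrite [rnorm (inl_map _)]rnorm_pair ge_max /= lexx rnorm0 rnorm_ge0.
Qed.

Section Parametrization.
Context (A : operator V U) (B : operator U V).
Context (KA KB : normedModType R[i]).
Context (a : {linear KA -> (V * U)%type}) (b : {linear KB -> (U * V)%type}).
Hypotheses (a_graph : range a = graph A) (b_graph : range b = graph B).
Hypotheses (a_inj : injective a) (b_inj : injective b).
Hypothesis rsAB : resolvent_set (comp_op A B) mu.

Let G := system_map \o pair_map a b.
Let F := outer_map \o pair_map a b.

(** A kernel element has [y = B x] and [A y = mu x], so [(A B - mu) x = 0] and [x = 0]. Both graph
    points then vanish, and so do their parameters. *)
Lemma system_inj k : G k = 0 -> k = 0.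
Proof.
case: k => k l [/eqP+ /eqP+] /=; rewrite !subr_eq0 => /eqP ka /eqP la.
have [domA aE] := graph_rangeP a_graph k.
have [domB bE] := graph_rangeP b_graph l.
case: rsAB => _ inj _.
have bl1 : (b l).1 = 0.
  apply: inj => /=; first by split=> //; rewrite -bE la.
    by split; [exact: dom0|rewrite op0; exact: dom0].
  by rewrite -bE la -aE ka subrr !op0 scaler0 subr0.
have bl : b l = 0.
  by rewrite [b l]surjective_pairing bE bl1 op0.
have ak : a k = 0.
  by rewrite [a k]surjective_pairing ka -la bl /= scaler0.
congr pair; first by apply: a_inj; rewrite linear0.
by apply: b_inj; rewrite linear0.
Qed.

(** The parameters over [B x] and [x] make the second equation hold. This shows that the whole graph
    of [A B] is reached. *)
Lemma system_inl x : dom (comp_op A B) x -> exists k,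
  G k = inl_map (A (B x) - mu *: x) /\ F k = (x, A (B x)).
Proof.
move=> [Bx ABx]; have [k kE] := graph_range_ex a_graph ABx.
have [l lE] := graph_range_ex b_graph Bx.
by exists (k, l); rewrite /G /F /= /system_map /outer_map /= kE lE /= subrr.
Qed.

(** Conversely, solutions over [(y, 0)] give graph points of [A B]; recovering [y] from such a point
    yields injectivity of the parametrization. *)
Lemma outer_inl k y : G k = inl_map y ->
  graph (comp_op A B) (F k) /\ y = (F k).2 - mu *: (F k).1.
Proof.
case: k => k l [] /= <- /eqP; rewrite subr_eq0 => /eqP la.
have [domA aE] := graph_rangeP a_graph k.
have [domB bE] := graph_rangeP b_graph l.
by split=> //; split; [split=> //=; rewrite -bE la|rewrite /= -bE la].
Qed.

Hypothesis rsBA : resolvent_set (comp_op B A) mu.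

Lemma system_surj p : exists k, G k = p.
Proof.
case: p => f g.
case: rsAB => _ _ /(_ f)[x domx /= xf].
have [k1 [Gk1 _]] := system_inl domx.
case: rsBA => _ _ /(_ g)[w [Aw BAw] /= wg].
have [k kE] := graph_range_ex a_graph Aw.
have [l lE] := graph_range_ex b_graph BAw.
(* [k1] solves for [(f, 0)]. The second summand lies over [mu w] and [A w], so its first equation
   cancels and its second reads [(B A - mu) w = g]. *)
exists (k1 + (mu *: k, l)).
rewrite /G linearD [X in X + _]Gk1 xf /= /system_map /= linearZ_LR kE lE /=.
by congr pair => /=; rewrite ?subrr ?addr0 ?wg ?add0r.
Qed.

End Parametrization.
End ProductOperator.

(** * Holomorphy of the product *)

Section CompHolomorphic.
Context (R : realType).

(** The hypotheses are symmetric in [A] and [B], so exchanging the two families gives the other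
    product. *)
Lemma holomorphic_comp_op (U V : completeNormedModType R[i])
    (Theta : set R[i]^o) (A : R[i] -> operator V U) (B : R[i] -> operator U V)
    (mu : R[i]) :
  holomorphic_op Theta A -> holomorphic_op Theta B ->
  (forall z, Theta z -> resolvent_set (comp_op (A z) (B z)) mu) ->
  (forall z, Theta z -> resolvent_set (comp_op (B z) (A z)) mu) ->
  holomorphic_op Theta (fun z => comp_op (A z) (B z)).
Proof.
move=> holA holB rsAB rsBA.
have closedAB z : Theta z -> closed_op (comp_op (A z) (B z)).
  by move=> /rsAB[cl _ _]; exact: closed_sub_scalar cl.
move=> z0 Theta_z0; split; first exact: closedAB.
have [_ [TA [oTA TAz0 TATheta [KA [a [a_par a_diff]]]]]] := holA _ Theta_z0.
have [_ [TB [oTB TBz0 TBTheta [KB [b [b_par b_diff]]]]]] := holB _ Theta_z0.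
pose T : set R[i]^o := TA `&` TB.
have oT : open T by exact: openI.
have Tz0 : T z0 by [].
have TTheta z : T z -> Theta z by move=> [/TATheta].
have a_bnd z : TA z -> bounded_op (a z) by move=> /a_par[].
have b_bnd z : TB z -> bounded_op (b z) by move=> /b_par[].
have [Da bDa dera] := (opnorm_differentiableP oTA TAz0 a_bnd).1 a_diff.
have [Db bDb derb] := (opnorm_differentiableP oTB TBz0 b_bnd).1 b_diff.
pose s : {linear _ -> _} := @system_map R U V mu.
pose o : {linear _ -> _} := @outer_map R U V.
pose Q z : {linear (KA * KB)%type -> _} := pair_map (a z) (b z).
pose DQ : {linear (KA * KB)%type -> _} := pair_map Da Db.
pose G z : {linear (KA * KB)%type -> (U * V)%type} := s \o Q z.
pose F z : {linear (KA * KB)%type -> (U * U)%type} := o \o Q z.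
have bQ z : T z -> bounded_op (Q z).
  by move=> [/a_bnd ? /b_bnd ?]; exact: bounded_pair_map.
have bDQ : bounded_op DQ by exact: bounded_pair_map.
have derQ : has_deriv (fun z => Q z) DQ z0 by exact: has_deriv_pair_map.
have bs : bounded_op s by exact: bounded_system_map.
have bo : bounded_op o by exact: bounded_outer_map.
have surjG z : T z -> forall p, exists k, G z k = p.
  move=> Tz; have [/a_par[_ _ _ Ea] /b_par[_ _ _ Eb]] := Tz.
  exact: (system_surj Ea Eb (rsAB _ (TTheta _ Tz)) (rsBA _ (TTheta _ Tz))).
have injG z k : T z -> G z k = 0 -> k = 0.
  move=> Tz; have [/a_par[_ ia _ Ea] /b_par[_ ib _ Eb]] := Tz.
  exact: (system_inj Ea Eb ia ib (rsAB _ (TTheta _ Tz))).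
have lowerG z : T z -> exists2 C : R, 0 <= C &
    forall k, rnorm k <= C * rnorm (G z k).
  move=> Tz.
  have /bounded_opP bG : bounded_op (G z).
    by apply: bounded_comp => //; exact: bQ.
  have [C C0 openG] := open_mapping (surjG _ Tz) bG.
  exists C => // k; have [k' Gk' k'C] := openG (G z k).
  (* By injectivity, the preimage of controlled norm supplied by [open_mapping] is [k] itself. *)
  suff -> : k = k' by rewrite Gk'.
  apply/eqP; rewrite -subr_eq0; apply/eqP/(injG _ _ Tz).
  by rewrite linearB Gk' subrr.
(* [H z] is [F z] composed with the inverse of [G z]; outside [T] it is set to zero, as the family
   must be total. *)
have /choice[H HP] z : exists H : {linear (U * V)%type -> (U * U)%type},
    T z -> bounded_op H /\ forall k, H (G z k) = F z k.
  have [Tz|nTz] := pselect (T z); last by exists \0.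
  have [C C0 GC] := lowerG _ Tz.
  have [|H bH HG] := linear_factor C0 (surjG _ Tz) GC (F := F z).
    by apply: bounded_comp => //; exact: bQ.
  by exists H.
have [C C0 GC] := lowerG _ Tz0.
have [bH0 HG0] := HP _ Tz0.
(* The numerator [F' - F G^-1 G'] of the quotient rule at [z0]; factoring it through [G z0] gives
   the derivative [D]. *)
pose N : {linear (KA * KB)%type -> (U * U)%type} :=
  (o \o DQ) \- (H z0 \o (s \o DQ)).
have [|D bD DE] := linear_factor C0 (surjG _ Tz0) GC (F := N).
  apply: bounded_sub; first exact: bounded_comp.
  by apply: bounded_comp => //; exact: bounded_comp.
have derH : has_deriv (fun z => H z) D z0.
  apply: (has_deriv_quotient oT Tz0 C0 surjG GC (F := F)
    (DF := o \o DQ) (DG := s \o DQ)) => //.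
  - by move=> z /HP[].
  - exact: bounded_comp.
  - exact: has_deriv_compl.
  - exact: has_deriv_compl.
exists T; split=> //; exists U.
pose i : {linear _ -> _} := @inl_map R U V.
have bi : bounded_op i by exact: bounded_inl_map.
exists (fun z => H z \o i).
have bL z : T z -> bounded_op (H z \o i).
  by move=> /HP[bH _]; exact: bounded_comp.
split=> [z Tz|]; last first.
  apply/(opnorm_differentiableP oT Tz0 bL).
  exists (D \o i); first exact: bounded_comp.
  exact: has_deriv_compr.
have [/a_par[_ _ _ Ea] /b_par[_ _ _ Eb]] := Tz.
have [bH HG] := HP _ Tz.
(* The first half puts the range inside the graph; the second is a left inverse, which proves
   injectivity below. *)
have HiE y : graph (comp_op (A z) (B z)) (H z (i y)) /\
    y = (H z (i y)).2 - mu *: (H z (i y)).1.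
  have [k Gk] := surjG _ Tz (i y).
  by rewrite -Gk HG; exact: (outer_inl Ea Eb Gk).
have rangeE : range (H z \o i) = graph (comp_op (A z) (B z)).
  apply/seteqP; split=> [_ [y _ <-]|]; first by have [] := HiE y.
  move=> [x y] [/= domx ->].
  have [k [Gk Fk]] := system_inl mu Ea Eb domx.
  by exists (A z (B z x) - mu *: x) => //=; rewrite -[i _]Gk -Fk -HG.
split=> //.
- exact: bL.
- move=> y y' /= Hyy'.
  by have [_ ->] := HiE y; have [_ ->] := HiE y'; rewrite Hyy'.
- by rewrite rangeE; apply: closedAB; exact: TTheta.
Qed.

End CompHolomorphic.

Theorem theorem5p10 (R : realType) (H1 H2 : completeNormedModType R[i])
    (Theta : set R[i]^o) (oTheta : open Theta)
    (A : R[i] -> operator H2 H1) (B : R[i] -> operator H1 H2)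
    (holA : holomorphic_op Theta A) (holB : holomorphic_op Theta B)
    (hrs : exists lambda : R[i], forall z, Theta z ->
      (resolvent_set (comp_op (A z) (B z)) `&`
       resolvent_set (comp_op (B z) (A z))) (lambda ^+ 2)) :
  holomorphic_op Theta (fun z => comp_op (A z) (B z)) /\
  holomorphic_op Theta (fun z => comp_op (B z) (A z)).
Proof.
have [lambda rs] := hrs.
by split; apply: (holomorphic_comp_op (mu := lambda ^+ 2)) => // z /rs[].
Qed.
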